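(* Let $\mathcal{T}\in\mathbb{R}^{m_1\times\cdots\times m_M}$ be a tensor given as a tensor network in which $\mathcal{G}\in\mathbb{R}^{n_1\times\cdots\times n_N}$ is a core tensor. If $\mathcal{G}$ appears $k$ times in the tensor network of $\mathcal{T}$ (i.e. exactly $k$ vertices carry the tensor $\mathcal{G}$, and the tensors carried by the other vertices do not depend on $\mathcal{G}$), then the Jacobian tensor $\frac{\partial\mathcal{T}}{\partial\mathcal{G}}\in\mathbb{R}^{m_1\times\cdots\times m_M\times n_1\times\cdots\times n_N}$ of $\mathcal{T}$, regarded as a function of $\mathcal{G}$, is obtained by summing $k$ copies of the tensor network of $\mathcal{T}$, where a different occurrence of $\mathcal{G}$ is removed in each copy.
   Context: Tensor network: a finite set $V$ of vertices, each vertex $v$ carrying a real tensor (called a core tensor) whose modes are called the legs of $v$. Some of the legs (of all vertices taken together) are matched in pairs of equal dimension; each matched pair is an edge (parallel edges and loops are allowed). The unmatched legs are the dangling legs, numbered $1,\dots,M$, with dimensions $m_1,\dots,m_M$. The tensor $\mathcal{T}$ represented by the network has entry $\mathcal{T}_{i_1,\dots,i_M}$ equal to the sum, over all assignments of an index $r_e$ (ranging over the dimension of $e$) to each edge $e$, of the product over the vertices $v$ of the entry of the tensor at $v$ at the indices carried by its legs (index $r_e$ on a leg belonging to edge $e$, index $i_q$ on the $q$-th dangling leg). Jacobian tensor: for $f:\mathbb{R}^{n_1\times\cdots\times n_N}\to\mathbb{R}^{m_1\times\cdots\times m_M}$, $\frac{\partial f(\theta)}{\partial\theta}\in\mathbb{R}^{m_1\times\cdots\times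 m_M\times n_1\times\cdots\times n_N}$ has entries $\left(\frac{\partial f(\theta)}{\partial \theta}\right)_{i_1,\dots,i_M,j_1,\dots,j_N}=\frac{\partial f(\theta)_{i_1,\dots,i_M}}{\partial\theta_{j_1,\dots,j_N}}$. Removing an occurrence of a core: removing a node $v_0$ carrying $\mathcal{G}$ deletes only that node and leaves all of its legs in place, their freed ends becoming new dangling legs indexed by $j_1,\dots,j_N$ (the modes of $\mathcal{G}$). Explicitly, the entry at $(i_1,\dots,i_M,j_1,\dots,j_N)$ of the resulting tensor is $$\sum \ \prod_{v\neq v_0}(\text{entry of the tensor at }v)\ \cdot\prod_{(q,l)}\delta_{i_q j_l}\ \cdot\prod_{\{l,l'\}}\delta_{j_l j_{l'}},$$ where the sum is over assignments of indices to the edges not incident to $v_0$; a leg of a vertex $v\neq v_0$ that was joined to the $l$-th mode of the removed copy of $\mathcal{G}$ carries the index $j_l$; the product over $(q,l)$ runs over the pairs such that the $q$-th dangling leg of the network is the $l$-th mode of the removed copy of $\mathcal{G}$; and the product over $\{l,l'\}$ runs over loops at $v_0$ joining its modes $l$ and $l'$. The other occurrences of $\mathcal{G}$ stay in the network. Here $\delta$ is the Kronecker delta (an edge with no node is an identity matrix). *)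

(* Defs.v *)
From HB Require Import structures.
From mathcomp Require Import all_boot all_order all_algebra.
From mathcomp Require Import reals topology normedtype derive.

Set Implicit Arguments.
Unset Strict Implicit.
Unset Printing Implicit Defensive.

Import GRing.Theory numFieldNormedType.Exports.
Local Open Scope ring_scope.

Record tshape := TShape { nmodes : nat; mdim : 'I_nmodes -> nat }.

Definition midx (s : tshape) := {dffun forall l : 'I_(nmodes s), 'I_(mdim l)}.

Definition tensor (R : Type) (s : tshape) := {ffun midx s -> R}.

(** The shape [m_1 x ... x m_M x n_1 x ... x n_N]; a multi-index [ij] of it is
    split into its first [M] components [lidx ij] and its last [N] components
    [ridx ij]. *)

Definition catsh (m n : tshape) : tshape :=
  @TShape (nmodes m + nmodes n)
    (fun l => match split l with inl q => mdim q | inr p => mdim p end).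

Lemma dim_lshift (m n : tshape) (q : 'I_(nmodes m)) :
  @mdim (catsh m n) (lshift (nmodes n) q) = mdim q.
Proof. by rewrite /= (unsplitK (inl q)). Qed.

Lemma dim_rshift (m n : tshape) (p : 'I_(nmodes n)) :
  @mdim (catsh m n) (rshift (nmodes m) p) = mdim p.
Proof. by rewrite /= (unsplitK (inr p)). Qed.

Definition lidx (m n : tshape) (ij : midx (catsh m n)) : midx m :=
  finfun (fun q : 'I_(nmodes m) =>
    cast_ord (dim_lshift n q) (ij (lshift (nmodes n) q))).

Definition ridx (m n : tshape) (ij : midx (catsh m n)) : midx n :=
  finfun (fun p : 'I_(nmodes n) =>
    cast_ord (dim_rshift m p) (ij (rshift (nmodes m) p))).

Section Jacobian.
Variables (R : realType) (n m : tshape).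
Implicit Types (f : tensor R n -> tensor R m) (theta : tensor R n).

Definition set_entry theta (j : midx n) (t : R) : tensor R n :=
  [ffun j' => if j' == j then t else theta j'].

Definition has_partials f theta : Prop :=
  forall (i : midx m) (j : midx n),
    derivable (fun t : R => f (set_entry theta j t) i) (theta j) 1.

Definition partial_deriv f theta (i : midx m) (j : midx n) : R :=
  derive1 (fun t : R => f (set_entry theta j t) i) (theta j).

Definition jacobian_tensor f theta : tensor R (catsh m n) :=
  [ffun ij => partial_deriv f theta (lidx ij) (ridx ij)].

End Jacobian.

(** [K] is a type of names of core tensors and [sh] gives their shapes.  Each
    vertex [v] carries the core tensor named [core v], so that vertices with
    the same name are occurrences of the same tensor.  Legs are the pairs of a
    vertex and a mode of its core.  Each leg lies on a wire, which is either an
    edge (made of exactly two legs, possibly at the same vertex) or one of the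
    numbered dangling legs (made of exactly one leg). *)
Record network (K : eqType) (sh : K -> tshape) (m : tshape) := Network {
  vertex : finType;
  edge : finType;
  core : vertex -> K;
  edim : edge -> nat;
  wire : {v : vertex & 'I_(nmodes (sh (core v)))} -> edge + 'I_(nmodes m);
  wire_edge : forall e : edge, #|[pred x | wire x == inl e]| = 2;
  wire_dangling : forall q : 'I_(nmodes m), #|[pred x | wire x == inr q]| = 1;
  wire_dim : forall x,
    match wire x with inl e => edim e | inr q => mdim q end = mdim (tagged x)
}.

Section Network.
Variables (R : realType) (K : eqType) (sh : K -> tshape) (m : tshape).
Variable T : network sh m.

Definition leg := {v : vertex T & 'I_(nmodes (sh (core v)))}.

Definition mkleg (v : vertex T) (l : 'I_(nmodes (sh (core v)))) : leg :=
  Tagged (fun v => 'I_(nmodes (sh (core v)))) l.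

Definition wdim (w : edge T + 'I_(nmodes m)) : nat :=
  match w with inl e => edim e | inr q => mdim q end.

(** The index carried by the leg [x] when edges carry the indices [r] and
    dangling legs the indices [i]; the cast only changes the type. *)
Definition leg_idx (i : midx m) (r : forall e : edge T, 'I_(edim e)) (x : leg) :
    'I_(mdim (tagged x)) :=
  cast_ord (wire_dim x)
    (match wire x as w return 'I_(wdim w) with inl e => r e | inr q => i q end).

Definition vertex_idx (i : midx m) (r : forall e : edge T, 'I_(edim e))
    (v : vertex T) : midx (sh (core v)) :=
  finfun (fun l : 'I_(nmodes (sh (core v))) => leg_idx i r (mkleg l)).

(** The tensor represented by the network when the core named [c] is [A c]. *)
Definition contract (A : forall c : K, tensor R (sh c)) : tensor R m :=
  [ffun i => \sum_(r : {dffun forall e : edge T, 'I_(edim e)})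
    \prod_(v : vertex T) A (core v) (vertex_idx i r v)].

Section Remove.
Variable v0 : vertex T.

Definition joins (e : edge T) : pred 'I_(nmodes (sh (core v0))) :=
  [pred l | wire (mkleg l) == inl e].

Definition incident (e : edge T) : bool := [exists l, joins e l].

Definition free_edge := {e : edge T | ~~ incident e}.

Lemma joins_dim (e : edge T) (l : 'I_(nmodes (sh (core v0)))) :
  joins e l -> mdim l = edim e.
Proof. by move=> /eqP we; have := wire_dim (mkleg l); rewrite we. Qed.

Lemma joins_free (e : edge T) : joins e =1 xpred0 -> ~~ incident e.
Proof. by move=> e0; apply/existsPn => l; rewrite e0. Qed.

(** After the removal of [v0], an edge that joined another vertex to the mode
    [l] of [v0] carries the index [j l]; such an [l] is unique.  (Loops at [v0]
    are also given a value here, but no leg of another vertex lies on them.) *)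
Definition removed_edge_idx (j : midx (sh (core v0)))
    (r : forall e : free_edge, 'I_(edim (val e))) (e : edge T) : 'I_(edim e) :=
  match pickP (joins e) with
  | Pick l el => cast_ord (joins_dim el) (j l)
  | Nopick e0 => r (exist _ e (joins_free e0))
  end.

(** In the last product, two distinct modes of [v0] on the same wire form a
    loop, since a dangling wire has only one leg; [p.1 < p.2] selects each loop
    once. *)
Definition remove_node (A : forall c : K, tensor R (sh c)) :
    tensor R (catsh m (sh (core v0))) :=
  [ffun ij => let i := lidx ij in let j := ridx ij in
    \sum_(r : {dffun forall e : free_edge, 'I_(edim (val e))})
      (\prod_(v : vertex T | v != v0)
          A (core v) (vertex_idx i (removed_edge_idx j r) v)
       * \prod_(p : 'I_(nmodes m) * 'I_(nmodes (sh (core v0)))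
                  | wire (mkleg p.2) == inr p.1)
          (i p.1 == j p.2 :> nat)%:R
       * \prod_(p : 'I_(nmodes (sh (core v0))) * 'I_(nmodes (sh (core v0)))
                  | (p.1 < p.2)%N && (wire (mkleg p.1) == wire (mkleg p.2)))
          (j p.1 == j p.2 :> nat)%:R)].

End Remove.

Definition occurrence (c : K) := {v : vertex T | core v == c}.

Definition remove_occurrence (A : forall c : K, tensor R (sh c)) (c : K)
    (v : occurrence c) : tensor R (catsh m (sh c)) :=
  ecast c' (tensor R (catsh m (sh c'))) (eqP (valP v)) (remove_node (val v) A).

End Network.

(* Main.v *)
(** By multilinearity, the product rule writes the partial derivative with
    respect to [G_j] as a sum over the occurrences [v0] of [G] and over the edge
    assignments [r], the factor of [v0] being replaced by the indicator that its
    legs carry the multi-index [j].  The assignments selected by this indicator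
    are parametrized by the indices of the edges not incident to [v0], subject
    to the constraints that the Kronecker deltas of the removed network
    express. *)

Require Import Defs.
From mathcomp Require Import all_boot all_order all_algebra.
From mathcomp Require Import boolp functions.
From mathcomp Require Import reals topology normedtype derive.

Import GRing.Theory.
Import numFieldNormedType.Exports.
Set Implicit Arguments.
Unset Strict Implicit.
Unset Printing Implicit Defensive.

Local Open Scope ring_scope.

(** Turns each product of Kronecker deltas in [remove_node] into the indicator of one boolean
    condition. *)
Lemma prodr_bool (R : comPzRingType) (I : finType) (P b : pred I) :
  \prod_(p | P p) (b p)%:R = [forall p, P p ==> b p]%:R :> R.
Proof.
case: forallP => [Pb | /forallP/forallPn[p]].
  by apply: big1 => p Pp; have := Pb p; rewrite Pp => /= ->.
by rewrite negb_imply => /andP[Pp /negPf bp]; rewrite (bigD1 p) //= bp mul0r.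
Qed.

Lemma is_derive_prod (R : realType) (I : finType) (f : I -> R -> R)
    (df : I -> R) (x : R) :
  (forall i, is_derive x 1 (f i) (df i)) ->
  is_derive x 1 (fun t => \prod_i f i t)
    (\sum_i df i * \prod_(j | j != i) f j x).
Proof.
(* Induction on a duplicate-free list: [j != i] must drop exactly one factor. *)
move=> fdf; elim: (index_enum I) (index_enum_uniq I) => [_|i s IHs].
  have -> : (fun t => \prod_(i <- [::]) f i t) = fun=> 1.
    by apply: funext => t; rewrite big_nil.
  by rewrite big_nil; exact: is_derive_cst.
rewrite /= => /andP[is_ /IHs {}IHs].
have -> : (fun t => \prod_(j <- i :: s) f j t)
    = (fun t => f i t * \prod_(j <- s) f j t).
  by apply: funext => t; rewrite big_cons.
apply: (is_derive_eq (is_deriveM (fdf i) IHs)).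
have ni j : j \in s -> j != i by apply: contraTneq => ->.
rewrite !big_cons eqxx /= [RHS]addrC /GRing.scale /=; congr (_ + _).
  rewrite big_distrr /= big_seq [RHS]big_seq; apply: eq_bigr => j js.
  by rewrite big_cons eq_sym ni //= mulrCA.
rewrite mulrC; congr (_ * _); rewrite big_seq [RHS]big_seq_cond.
by apply: eq_bigl => j; rewrite andb_idr // => /ni.
Qed.

Lemma is_derive_bigsum (R : realType) (I : finType) (f : I -> R -> R)
    (df : I -> R) (x : R) :
  (forall i, is_derive x 1 (f i) (df i)) ->
  is_derive x 1 (fun t => \sum_i f i t) (\sum_i df i).
Proof.
move=> fdf; rewrite -fct_sumE.
by elim/big_ind2 : _ => // [|*]; [exact: is_derive_cst|exact: is_deriveD].
Qed.

Section Legs.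
Variables (R : realType) (K : eqType) (sh : K -> tshape) (m : tshape).
Variable T : network sh m.
Implicit Types (i : midx m) (r : forall e : edge T, 'I_(edim e)) (x : leg T).

(** Equality in [nat] avoids transport along the dimension cast. *)
Lemma leg_idx_edge i r x e : wire x = inl e -> leg_idx i r x = r e :> nat.
Proof. by rewrite /leg_idx /=; case: (wire x) => // e' [->]. Qed.

Lemma leg_idx_dangling i r x q :
  wire x = inr q -> leg_idx i r x = i q :> nat.
Proof. by rewrite /leg_idx /=; case: (wire x) => // q' [->]. Qed.

Lemma eq_vertex_idx i r r' v : (forall e, r e = r' e) ->
  vertex_idx i r v = vertex_idx i r' v.
Proof.
move=> rr'; apply/ffunP => l; rewrite !ffunE; apply: ord_inj.
case w: (wire (mkleg l)) => [e|q].
  by rewrite !(leg_idx_edge _ _ w) rr'.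
by rewrite !(leg_idx_dangling _ _ w).
Qed.

Variable v0 : vertex T.
Implicit Types (j : midx (sh (core v0))).
Implicit Types (s : forall e : free_edge v0, 'I_(edim (val e))).

Lemma vertex_idxP i r j :
  reflect (forall l, leg_idx i r (mkleg l) = j l :> nat)
          (vertex_idx i r v0 == j).
Proof.
apply: (iffP eqP) => [<- l|ij]; first by rewrite ffunE.
by apply/ffunP => l; apply: ord_inj; rewrite ffunE ij.
Qed.

(** The mode [l'] chosen by [pickP] may differ from [l]: a loop at [v0] has two modes and takes its
    index from one of them. *)
Lemma removed_edge_idx_joins j s e l : joins (v0 := v0) e l ->
  exists2 l', joins (v0 := v0) e l' & removed_edge_idx j s e = j l' :> nat.
Proof.
move=> el; rewrite /removed_edge_idx; case: pickP => [l' el'|e0].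
  by exists l'.
by rewrite e0 in el.
Qed.

Lemma removed_edge_idx_free j s (e : free_edge v0) :
  removed_edge_idx j s (val e) = s e.
Proof.
case: e => e he; rewrite /removed_edge_idx /=; case: pickP => [l el|e0].
  by move/existsPn: (he) => /(_ l); rewrite el.
by rewrite (bool_irrelevance (joins_free e0) he).
Qed.

(** On an edge to another vertex the extension agrees with [j] by construction. Constraints remain
    only at dangling legs of [v0] and at its loops, one for each Kronecker delta. *)
Lemma vertex_idx_removed i j s :
  (vertex_idx i (removed_edge_idx j s) v0 == j)
  = [forall p : 'I_(nmodes m) * 'I_(nmodes (sh (core v0))),
      (wire (mkleg p.2) == inr p.1) ==> (i p.1 == j p.2 :> nat)]
    && [forall p : 'I_(nmodes (sh (core v0))) * 'I_(nmodes (sh (core v0))),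
      ((p.1 < p.2)%N && (wire (mkleg p.1) == wire (mkleg p.2)))
      ==> (j p.1 == j p.2 :> nat)].
Proof.
apply/vertex_idxP/andP => [ij|[/forallP dang /forallP loop] l].
  split; apply/forallP => -[q l] /=; apply/implyP.
    by move=> /eqP w; rewrite -ij (leg_idx_dangling _ _ w).
  move=> /andP[_ /eqP w]; rewrite -!ij; case w': (wire (mkleg l)) => [e|q'].
    by rewrite w' in w; rewrite (leg_idx_edge _ _ w) (leg_idx_edge _ _ w').
  rewrite w' in w.
  by rewrite (leg_idx_dangling _ _ w) (leg_idx_dangling _ _ w').
case w: (wire (mkleg l)) => [e|q]; last first.
  by rewrite (leg_idx_dangling _ _ w); have := dang (q, l); rewrite /= w eqxx
    => /eqP.
have el : joins (v0 := v0) e l by apply/eqP.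
have [l' /eqP w' rj] := removed_edge_idx_joins j s el.
rewrite (leg_idx_edge _ _ w) rj.
(* If [l'] and [l] differ, [e] is a loop. Its delta is recorded only for the increasing pair, hence
   the two cases. *)
case: (ltngtP l' l) => [ll'|ll'|/val_inj -> //].
  by have := loop (l', l); rewrite /= ll' w w' eqxx => /eqP.
by have := loop (l, l'); rewrite /= ll' w w' eqxx => /eqP.
Qed.

(* Extending a free-edge assignment by [j] is a bijection onto the edge
   assignments under which the legs of [v0] carry the multi-index [j]. *)
Lemma remove_nodeE (A : forall c, tensor R (sh c))
    (ij : midx (catsh m (sh (core v0)))) :
  remove_node v0 A ij
  = \sum_(r : {dffun forall e : edge T, 'I_(edim e)}
            | vertex_idx (lidx ij) r v0 == ridx ij)
      \prod_(v | v != v0) A (core v) (vertex_idx (lidx ij) r v).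
Proof.
rewrite ffunE /=; set i := lidx ij; set j := ridx ij.
pose ext (s : {dffun forall e : free_edge v0, 'I_(edim (val e))}) :
    {dffun forall e : edge T, 'I_(edim e)} := finfun (removed_edge_idx j s).
pose res (r : {dffun forall e : edge T, 'I_(edim e)}) :
    {dffun forall e : free_edge v0, 'I_(edim (val e))} :=
  finfun (fun e : free_edge v0 => r (val e)).
have extE (s : {dffun forall e : free_edge v0, 'I_(edim (val e))}) v :
      vertex_idx i (ext s) v = vertex_idx i (removed_edge_idx j s) v.
  by apply: eq_vertex_idx => e; rewrite ffunE.
(* For [ext (res r) = r] on an incident edge: some leg [l'] of [v0] lies on it and carries [j l'],
   so [r] takes that value there. *)
rewrite [RHS](reindex_onto ext res) => [|r /vertex_idxP rj]; last first.
  apply/ffunP => e; rewrite ffunE; apply: ord_inj.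
  case: (boolP (incident v0 e)) => [/existsP[l el]|he].
    have [l' /eqP w ->] := removed_edge_idx_joins j (res r) el.
    by rewrite -rj (leg_idx_edge _ _ w).
  have -> : e = val (exist _ e he : free_edge v0) by [].
  by rewrite removed_edge_idx_free ffunE.
rewrite [RHS]big_mkcond /=; apply: eq_bigr => s _.
have -> : res (ext s) == s.
  by apply/eqP/ffunP => e; rewrite !ffunE removed_edge_idx_free.
rewrite andbT extE vertex_idx_removed.
pose N := 'I_(nmodes (sh (core v0))).
rewrite (prodr_bool R (fun p : 'I_(nmodes m) * N => wire (mkleg p.2) == inr p.1)
  (fun p => i p.1 == j p.2 :> nat)).
rewrite (prodr_bool R
  (fun p : N * N => (p.1 < p.2)%N && (wire (mkleg p.1) == wire (mkleg p.2)))
  (fun p => j p.1 == j p.2 :> nat)).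
(* Both sides vanish as soon as one of the two conditions fails. *)
do 2![case: [forall _, _]; rewrite ?mulr0 ?mulr1 //=].
by apply: eq_bigr => v _; rewrite extE.
Qed.
End Legs.

Definition delta_tensor (R : pzRingType) (n : tshape) (j : midx n) :
  tensor R n := [ffun j' => (j' == j)%:R].

(** The zero family with [delta_tensor] at [c] is the derivative of the family of cores in the entry
    [ridx ij], so each summand has the shape given by the product rule. *)
Lemma remove_occurrenceE (R : realType) (K : eqType) (sh : K -> tshape)
    (m : tshape) (T : network sh m) (A : forall c, tensor R (sh c)) (c : K)
    (u : occurrence T c) (ij : midx (catsh m (sh c))) :
  remove_occurrence A u ij
  = \sum_(r : {dffun forall e : edge T, 'I_(edim e)})
      dfwith (fun d => 0 : tensor R (sh d)) (delta_tensor R (ridx ij))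
        (core (val u)) (vertex_idx (lidx ij) r (val u))
      * \prod_(v | v != val u) A (core v) (vertex_idx (lidx ij) r v).
Proof.
(* With its proof generalized, the equality [core v = c] can be eliminated, which makes the cast
   disappear. *)
rewrite /remove_occurrence; case: u => v h /=; move: (eqP _) => e {h}.
case: c / e ij => ij /=; rewrite remove_nodeE dfwith_in big_mkcond /=.
by apply: eq_bigr => r _; rewrite ffunE; case: eqP; rewrite (mul1r, mul0r).
Qed.

Lemma set_entry_id (R : realType) (n : tshape) (G : tensor R n) (j : midx n) :
  set_entry G j (G j) = G.
Proof. by apply/ffunP => j'; rewrite ffunE; case: eqP => [->|]. Qed.

Section Derivative.
Variables (R : realType) (K : eqType) (sh : K -> tshape) (c : K).
Variables (A : forall d, tensor R (sh d)) (G : tensor R (sh c)).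

Lemma is_derive_core (j : midx (sh c)) (d : K) (a : midx (sh d)) :
  is_derive (G j) 1 (fun t : R => dfwith A (set_entry G j t) d a)
    (dfwith (fun d' => 0 : tensor R (sh d')) (delta_tensor R j) d a).
Proof.
case: (eqVneq c d) => [e|cd].
  case: d / e a => a; rewrite dfwith_in ffunE.
  have -> : (fun t : R => dfwith A (set_entry G j t) c a)
      = (fun t : R => if a == j then t else G a).
    by apply: funext => t; rewrite dfwith_in ffunE.
  by case: eqP => _; [exact: is_derive_id|exact: is_derive_cst].
rewrite dfwith_out // ffunE.
have -> : (fun t : R => dfwith A (set_entry G j t) d a) = fun=> A d a.
  by apply: funext => t; rewrite dfwith_out.
exact: is_derive_cst.
Qed.

Lemma is_derive_contract (m : tshape) (T : network sh m) (i : midx m)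
    (j : midx (sh c)) :
  is_derive (G j) 1
    (fun t : R => contract T (dfwith A (set_entry G j t)) i)
    (\sum_(r : {dffun forall e : edge T, 'I_(edim e)}) \sum_(v : vertex T)
      dfwith (fun d => 0 : tensor R (sh d)) (delta_tensor R j)
        (core v) (vertex_idx i r v)
      * \prod_(w | w != v) dfwith A G (core w) (vertex_idx i r w)).
Proof.
have -> : (fun t : R => contract T (dfwith A (set_entry G j t)) i)
  = (fun t : R => \sum_(r : {dffun forall e : edge T, 'I_(edim e)})
     \prod_(v : vertex T)
       dfwith A (set_entry G j t) (core v) (vertex_idx i r v)).
  by apply: funext => t; rewrite ffunE.
apply: is_derive_bigsum => r.
(* The product rule evaluates the untouched factors at [t = G j], where [set_entry] gives back
   [G]. *)
rewrite -[in X in is_derive _ _ _ X](set_entry_id G j).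
apply: (is_derive_prod
  (f := fun v t => dfwith A (set_entry G j t) (core v) (vertex_idx i r v))).
by move=> v; exact: is_derive_core.
Qed.
End Derivative.

Unset Implicit Arguments.

(* [dfwith A G] is the family of core tensors [A] in which the core named [c]
   is [G]. *)
Theorem theorem20 (R : realType) (K : eqType) (sh : K -> tshape) (m : tshape)
    (T : network sh m) (c : K) (A : forall c' : K, tensor R (sh c'))
    (k : nat) (occ : 'I_k -> occurrence T c) (hocc : bijective occ)
    (G : tensor R (sh c)) :
  has_partials (fun X : tensor R (sh c) => contract T (dfwith A X)) G /\
  jacobian_tensor (fun X : tensor R (sh c) => contract T (dfwith A X)) G
    = \sum_(a < k) remove_occurrence (dfwith A G) (occ a).
Proof.
split=> [i j|]; first by have [] := is_derive_contract A G T i j.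
apply/ffunP => ij; rewrite sum_ffunE ffunE /partial_deriv derive1E.
have [_ ->] := is_derive_contract A G T (lidx ij) (ridx ij).
(* Vertices with another core contribute zero; the others are then enumerated by [occ]. *)
rewrite exchange_big /= (bigID (fun v => core v == c)) /=.
rewrite [X in _ + X]big1 ?addr0; last first.
  move=> v vc; apply: big1 => r _.
  by rewrite dfwith_out 1?eq_sym // ffunE mul0r.
under [RHS]eq_bigr do rewrite remove_occurrenceE.
rewrite (big_sub [pred v | core v == c]) /=.
by rewrite (reindex occ (onW_bij _ hocc)).
Qed.
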